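(* For every integer $n\ge 1$, the set $\mathcal D_2(n)$ is the disjoint union $$\mathcal D_2(n)=\mathcal D_2^{\mathrm{HT}}(n)\,\dot\cup\,\mathcal D_2^{\mathrm{SP}}(n)\,\dot\cup\,\mathcal D_2^{\mathrm{SUB}}(n),\qquad \mathcal D_2^{\mathrm{MP}}(n)=\varnothing .$$ The three class sizes are $$|\mathcal D_2^{\mathrm{HT}}(n)|=\mathbf 1_{2\mid n}\,2^{\frac n2-1},$$ $$|\mathcal D_2^{\mathrm{SP}}(n)|=\mathbf 1_{3\mid n}\,\mathsf P(n/3)+\sum_{\substack{m\mid n\\ m\ge 4}}\frac{\varphi(m)}2\,2^{\frac nm-1}(m-3),$$ $$|\mathcal D_2^{\mathrm{SUB}}(n)|=\sum_{\substack{\tau\mid n\\ n/\tau\ \mathrm{odd}\\ n/\tau\ge 5}}\mathsf P(\tau).$$ Consequently, $$|\mathcal D_2(n)|=\mathbf 1_{2\mid n}\,2^{\frac n2-1}+\mathbf 1_{3\mid n}\sum_{d\mid (n/3)}\mu(d)\,2^{\frac n{3d}}+\sum_{\substack{m\mid n\\ m\ge 4}}\frac{\varphi(m)}2\,2^{\frac nm-1}(m-3)+\sum_{\substack{\tau\mid n\\ n/\tau\ \mathrm{odd}\\ n/\tau\ge 5}}\ \sum_{d\mid\tau}\mu(d)\,2^{\tau/d},$$ equivalently $$|\mathcal D_2(n)|=\mathbf 1_{2\mid n}\,2^{\frac n2-1}+\mathbf 1_{3\mid n}\,\mathsf P(n/3)+\sum_{\substack{m\mid n\\ m\ge 4}}\frac{\varphi(m)}2\,2^{\frac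 nm-1}(m-3)+\sum_{\substack{\tau\mid n\\ n/\tau\ \mathrm{odd}\\ n/\tau\ge 5}}\mathsf P(\tau).$$
   Context: Indices of a word $w\in\{0,1\}^n$ are read in $\mathbb Z/n\mathbb Z$. Rotation: $(\mathrm{rot}^k w)_i=w_{i-k}$. A binary necklace of length $n$ is an orbit $[w]$ of words in $\{0,1\}^n$ under rotation (no identification with reversals or complements). Let $\mathrm{d_H}$ be Hamming distance, $d_w(k)=\mathrm{d_H}(w,\mathrm{rot}^k w)$, and for $n\ge2$ let $\delta(w)=\min_{1\le k\le n-1}d_w(k)$ and $K_2(w)=\{k\in\{1,\dots,n-1\}:d_w(k)=2\}$. These depend only on the necklace $\mathcal N=[w]$; write $\delta(\mathcal N)$, $K_2(\mathcal N)$. Shifts in $\{1,\dots,n-1\}$ are identified with nonzero residues mod $n$. For $\tau\mid n$, $\tau(\mathbb Z/n\mathbb Z)\setminus\{0\}$ is the set of nonzero residues mod $n$ represented by multiples of $\tau$. For $K=\{k_1,\dots,k_r\}$, $\gcd(n,K)=\gcd(n,k_1,\dots,k_r)$. For $n\ge 2$, $\mathcal D_2(n)$ is the set of binary necklaces $\mathcal N$ of length $n$ with $\delta(\mathcal N)=2$. Each $\mathcal N\in\mathcal D_2(n)$, with $K=K_2(\mathcal N)$, is assigned to a class by priority: (HT) $\mathcal N\in\mathcal D_2^{\mathrm{HT}}(n)$ if $n$ is even and $n/2\in K$; (SP) if not HT, $\mathcal N\in\mathcal D_2^{\mathrm{SP}}(n)$ if $K=\{k,n-k\}$ for some $1\le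 k<n/2$; (SUB) if neither HT nor SP, $\mathcal N\in\mathcal D_2^{\mathrm{SUB}}(n)$ if $K=\tau(\mathbb Z/n\mathbb Z)\setminus\{0\}$ with $\tau=\gcd(n,K)$; (MP) $\mathcal N\in\mathcal D_2^{\mathrm{MP}}(n)$ in all remaining cases. For $n=1$ all five sets are defined to be empty. $\mathsf P(\ell)=\sum_{d\mid\ell}\mu(d)2^{\ell/d}$ (the number of primitive binary words of length $\ell$), $\mu$ is the Möbius function, $\varphi$ Euler's totient. $\mathbf 1_{\cdot}$ is an indicator; a term multiplied by an indicator equal to $0$ is interpreted as $0$ (the rest is not evaluated). *)

(* Defs.v *)
From mathcomp Require Import all_boot all_order all_algebra.

Set Implicit Arguments.
Unset Strict Implicit.
Unset Printing Implicit Defensive.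

Notation word n := (n.-tuple bool).

(* [rotr k] moves every letter k places to the right, i.e. (rot^k w)_i = w_(i-k)
   for 0 <= k <= n: see [tnth_rotw]. *)
Definition rotw n (k : nat) (w : word n) : word n := [tuple of rotr k w].

Definition necklace n (w : word n) : {set word n} := [set rotw k w | k : 'I_n].

Definition necklaces n : {set {set word n}} := [set necklace w | w : word n].

Definition hamming n (u v : word n) : nat :=
  #|[set i : 'I_n | tnth u i != tnth v i]|.

Definition shift_dist n (w : word n) (k : nat) : nat := hamming w (rotw k w).

(* For 2 <= n the range is nonempty and every term is at most n, so the initial
   value n does not affect the minimum. *)
Definition delta_word n (w : word n) : nat :=
  \big[minn/n]_(1 <= k < n) shift_dist w k.

(* Shifts in {1, .., n-1}, i.e. nonzero residues mod n, are the k : 'I_n with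
   0 < k. *)
Definition K2_word n (w : word n) : {set 'I_n} :=
  [set k : 'I_n | (0 < k) && (shift_dist w k == 2)].

(* A word of the necklace N; the default is only used when N is empty.
   [delta_necklace] and [K2_necklace] show that the choice is irrelevant. *)
Definition repr_word n (N : {set word n}) : word n :=
  odflt [tuple of nseq n false] [pick w in N].

Definition delta n (N : {set word n}) : nat := delta_word (repr_word N).
Definition K2 n (N : {set word n}) : {set 'I_n} := K2_word (repr_word N).

Definition gcd_shifts n (K : {set 'I_n}) : nat := \big[gcdn/n]_(k in K) k.

(* tau (Z/nZ) \ {0} *)
Definition multiples n (tau : nat) : {set 'I_n} :=
  [set j : 'I_n | (0 < j) && [exists i : 'I_n, j == tau * i %[mod n]]].

Definition isHT n (K : {set 'I_n}) : bool :=
  (2 %| n) && [exists k in K, k == n %/ 2 :> nat].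

Definition isSP n (K : {set 'I_n}) : bool :=
  [exists k : 'I_n, [&& 1 <= k, 2 * k < n &
     K == [set j : 'I_n | (j == k :> nat) || (j == n - k :> nat)]]].

Definition isSUB n (K : {set 'I_n}) : bool := K == multiples n (gcd_shifts K).

(* The guard 1 < n makes D2 1 and its four classes empty. *)
Definition D2 n : {set {set word n}} :=
  [set N in necklaces n | (1 < n) && (delta N == 2)].

Definition D2HT n : {set {set word n}} := [set N in D2 n | isHT (K2 N)].

Definition D2SP n : {set {set word n}} :=
  [set N in D2 n | ~~ isHT (K2 N) && isSP (K2 N)].

Definition D2SUB n : {set {set word n}} :=
  [set N in D2 n | [&& ~~ isHT (K2 N), ~~ isSP (K2 N) & isSUB (K2 N)]].

Definition D2MP n : {set {set word n}} :=
  [set N in D2 n | [&& ~~ isHT (K2 N), ~~ isSP (K2 N) & ~~ isSUB (K2 N)]].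

Section Arithmetic.
Local Open Scope ring_scope.
Import GRing.Theory.

Definition squarefree (d : nat) : bool :=
  (0 < d)%N && all (fun p => logn p d == 1%N) (primes d).

Definition mobius (d : nat) : rat :=
  if squarefree d then (-1) ^+ size (primes d) else 0.

(* P(l): by Moebius inversion, the number of primitive binary words of length l. *)
Definition prim_words (l : nat) : rat :=
  \sum_(d <- divisors l) mobius d * 2 ^+ (l %/ d)%N.

End Arithmetic.

Lemma tnth_rotw n (k : nat) (w : word n) (i : 'I_n) : k <= n ->
  tnth (rotw k w) i = nth false w ((i + (n - k)) %% n).
Proof.
move=> lekn; rewrite (tnth_nth false) /= /rotr size_tuple /rot nth_cat.
rewrite size_drop size_tuple subKn // nth_drop.
have ltin := ltn_ord i; case: ltnP => [ltik | leki].
  by rewrite addnC modn_small // addnC -ltn_subRL subKn.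
have E : i + (n - k) = i - k + n by rewrite addnBA // addnBAC.
rewrite E modnDr modn_small ?(leq_ltn_trans (leq_subr _ _)) //.
by rewrite nth_take // ltn_sub2r // (leq_ltn_trans leki).
Qed.

Lemma hammingE n (u v : word n) :
  hamming u v = \sum_(p <- zip u v) (p.1 != p.2).
Proof.
rewrite /hamming -sum1dep_card big_mkcond /=.
rewrite (big_nth (false, false)) size_zip !size_tuple minnn big_mkord.
apply: eq_bigr => i _; rewrite nth_zip ?size_tuple //= !(tnth_nth false).
by case: (_ != _).
Qed.

Lemma hamming_rotw n j (u v : word n) :
  hamming (rotw j u) (rotw j v) = hamming u v.
Proof.
rewrite !hammingE /= /rotr !size_tuple /rot; set m := n - j.
rewrite -[in RHS](cat_take_drop m u) -[in RHS](cat_take_drop m v).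
by rewrite !zip_cat ?size_take ?size_drop ?size_tuple // !big_cat /= addnC.
Qed.

Lemma shift_dist_rotw n j k (w : word n) :
  shift_dist (rotw j w) k = shift_dist w k.
Proof.
rewrite /shift_dist -[RHS](hamming_rotw j); congr (hamming _ _).
by apply: val_inj => /=; rewrite rotr_rotr.
Qed.

Lemma repr_necklace n (w : word n) :
  exists j, repr_word (necklace w) = rotw j w.
Proof.
rewrite /repr_word; case: pickP => [u /imsetP[j _ ->] | nocc] /=; first by exists j.
case: n w nocc => [|n] w nocc; first by exists 0; rewrite [LHS]tuple0 [RHS]tuple0.
by have := nocc (rotw (ord0 : 'I_n.+1) w); rewrite [_ \in _]imset_f.
Qed.

Lemma delta_necklace n (w : word n) : delta (necklace w) = delta_word w.
Proof.
rewrite /delta; have [j ->] := repr_necklace w.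
by apply: eq_bigr => k _; apply: shift_dist_rotw.
Qed.

Lemma K2_necklace n (w : word n) : K2 (necklace w) = K2_word w.
Proof.
rewrite /K2; have [j ->] := repr_necklace w.
by apply/setP => k; rewrite !inE shift_dist_rotw.
Qed.

(* Main.v *)
(** A shift [k] of order [m] in Z/N splits Z/N into [N/m] cosets.  If [w] and its
    rotation by [k] differ in exactly two places, one coset carries a cyclic
    interval of [a] ones, [0 < a < m], and [w] is constant on each of the others.
    Comparing two such shifts [k] and [j] of the same word (lemma [jump2]) shows
    that [j = k] or [j = - k] unless [a = 1] or [a = m - 1].  In these two cases
    [w] is a periodic word with a single letter flipped, and its shifts at
    distance 2 are exactly the nonzero periods of that word.  Hence, when
    [N/2] is not such a shift, [K2] is either a pair [{k, - k}] or the set of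
    nonzero multiples of an exact period [t] with [N/t] odd, which is a pair
    only for [N/t = 3].  Since all these words are primitive, counting words
    and dividing by [N] counts necklaces. *)
Require Import Defs.
From mathcomp Require Import all_boot all_order all_algebra.
From mathcomp Require Import zify ring.

Set Implicit Arguments.
Unset Strict Implicit.
Unset Printing Implicit Defensive.

Import GRing.Theory Num.Theory.

Local Open Scope ring_scope.

(** * Moebius inversion *)

Lemma mobius_eq0 p d : prime p -> (0 < d)%N -> (p ^ 2 %| d)%N -> mobius d = 0.
Proof.
move=> p_pr d_gt0 p2d; rewrite /mobius /squarefree d_gt0 /=.
case: allP => // /(_ p); rewrite mem_primes p_pr d_gt0 /=.
rewrite (dvdn_trans _ p2d) ?dvdn_exp // => /(_ isT) /eqP lp1.
by move: p2d; rewrite pfactor_dvdn // lp1.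
Qed.

Lemma mobius_primeM p e :
  prime p -> (0 < e)%N -> ~~ (p %| e)%N -> mobius (p * e) = - mobius e.
Proof.
move=> p_pr e_gt0 pNe; have p_gt0 := prime_gt0 p_pr.
have perm_pe : perm_eq (primes (p * e)) (p :: primes e).
  apply: uniq_perm; rewrite /= ?primes_uniq ?andbT //.
    by rewrite mem_primes p_pr e_gt0.
  by move=> q; rewrite primesM // primes_prime // !inE.
rewrite /mobius (perm_size perm_pe) /= exprS mulN1r.
suff -> : squarefree (p * e) = squarefree e by case: ifP; rewrite ?oppr0.
rewrite /squarefree muln_gt0 p_gt0 e_gt0 /= (perm_all _ perm_pe) /=.
rewrite lognM // logn_prime // eqxx lognE p_pr e_gt0 (negPf pNe) /=.
apply: eq_in_all => q; rewrite mem_primes => /and3P[q_pr _ qe].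
rewrite lognM // logn_prime //; case: (eqVneq q p) qe => // -> pe.
by rewrite pe in pNe.
Qed.

(** For a prime [p] dividing [n], the divisors divisible by [p ^ 2] contribute 0, and [e -> p * e]
    pairs the divisors prime to [p] with those divisible by [p] exactly once, with opposite
    signs. *)
Lemma sum_mobius n : (0 < n)%N -> \sum_(d <- divisors n) mobius d = (n == 1%N)%:R.
Proof.
move=> n_gt0; case: eqP => [-> | /eqP n_neq1]; first by rewrite big_seq1.
have n_gt1 : (1 < n)%N by case: n n_gt0 n_neq1 => [|[]].
set p := pdiv n; have p_pr : prime p by apply: pdiv_prime.
have p_gt0 := prime_gt0 p_pr; have pn : (p %| n)%N by apply: pdiv_dvd.
rewrite (bigID (fun d => (p %| d)%N)) /= (bigID (fun d => (p ^ 2 %| d)%N)) /=.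
rewrite big1_seq ?add0r; last first.
  move=> d /andP[/andP[_ p2d]]; rewrite -dvdn_divisors // => dn.
  by apply: (mobius_eq0 p_pr) => //; apply: dvdn_gt0 dn.
rewrite -big_filter -[X in _ + X]big_filter.
rewrite (perm_big [seq (p * e)%N | e <- [seq e <- divisors n | ~~ (p %| e)%N]]).
  rewrite big_map /= !big_filter -big_split big1_seq // => e /=.
  case/andP=> pNe; rewrite -dvdn_divisors // => en.
  by rewrite mobius_primeM ?addNr //; apply: dvdn_gt0 en.
apply: uniq_perm => [||d]; first by rewrite filter_uniq ?divisors_uniq.
  rewrite map_inj_uniq ?filter_uniq ?divisors_uniq //.
  by move=> a b /eqP; rewrite eqn_pmul2l // => /eqP.
rewrite mem_filter -dvdn_divisors //; apply/idP/mapP => /=.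
  case/andP=> /andP[/dvdnP[e ->]]; rewrite mulnC => p2 dn; exists e => //.
  rewrite mem_filter -dvdn_divisors // (dvdn_trans _ dn) ?dvdn_mull // andbT.
  by move: p2; rewrite -mulnn dvdn_pmul2l.
case=> e; rewrite mem_filter -dvdn_divisors // => /andP[pNe en] ->.
rewrite dvdn_mulr //= -mulnn dvdn_pmul2l // pNe /= Gauss_dvd ?pn //.
by rewrite prime_coprime.
Qed.

(** Expanding [2 ^+ (l / d)] by the hypothesis gives a double sum over [d * e | l]. After the
    exchange, the inner sum of [mobius] over the divisors of [l / e] vanishes unless [e = l]. *)
Lemma prim_words_inversion (f : nat -> rat) l : (0 < l)%N ->
    (forall e, (e %| l)%N -> \sum_(d <- divisors e) f d = 2 ^+ e) ->
  prim_words l = f l.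
Proof.
move=> l_gt0 sumf; rewrite /prim_words.
have dgt0 d : (d %| l)%N -> (0 < d)%N by move/dvdn_gt0; apply.
transitivity (\sum_(d <- divisors l) \sum_(e <- divisors l | (d * e %| l)%N)
                 mobius d * f e).
  apply: eq_big_seq => d; rewrite -dvdn_divisors // => dl.
  have ld : (l %/ d %| l)%N by rewrite dvdn_div.
  rewrite -sumf // -mulr_sumr; congr (_ * _).
  rewrite -[RHS]big_filter; apply: perm_big; apply: uniq_perm.
  - exact: divisors_uniq.
  - by rewrite filter_uniq ?divisors_uniq.
  move=> e; rewrite mem_filter -!dvdn_divisors ?dgt0 //.
  rewrite dvdn_divRL // mulnC; apply/idP/andP => [del|[]//]; split=> //.
  by apply: dvdn_trans del; rewrite dvdn_mull.
rewrite (exchange_big_dep xpredT) //= (bigD1_seq l) ?divisors_uniq //=; last first.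
  by rewrite -dvdn_divisors.
rewrite [X in _ + X]big1_seq ?addr0.
  rewrite -mulr_suml; under eq_bigl do rewrite -[X in (_ %| X)%N]mul1n dvdn_pmul2r //.
  rewrite big_mkcond (bigD1_seq 1%N) ?divisors_uniq -?dvdn_divisors ?dvd1n //=.
  rewrite big1 => [|i /negPf i1]; last by rewrite dvdn1 i1.
  by rewrite addr0 mul1r.
move=> e /andP[e_neql]; rewrite -dvdn_divisors // => el.
have le_gt0 : (0 < l %/ e)%N by rewrite dgt0 ?dvdn_div.
rewrite -mulr_suml -big_filter.
rewrite (perm_big (divisors (l %/ e))).
  rewrite sum_mobius //; case: eqP => [le1|]; last by rewrite mul0r.
  by move: e_neql; rewrite -[X in _ != X](divnK el) le1 mul1n eqxx.
apply: uniq_perm; rewrite ?filter_uniq ?divisors_uniq // => d.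
rewrite mem_filter -!dvdn_divisors // dvdn_divRL //.
by apply/andP/idP => [[]//|del]; split=> //; apply: dvdn_trans del; rewrite dvdn_mulr.
Qed.
(** * Shifts at distance two *)

Section Jumps.
Variable n : nat.
Local Notation N := n.+2.
Local Notation G := 'I_n.+2.
Implicit Types (w u v : word N) (i j k x y : G).

Lemma tnth_rotw_sub w k i : tnth (rotw k w) i = tnth w (i - k).
Proof.
rewrite tnth_rotw ?(ltnW (ltn_ord k)) // (tnth_nth false) /=.
by rewrite modnDmr.
Qed.

(* [w - rot^k w = e_x - e_y] as functions to the integers, with the negative
   terms moved to the other side. *)
Definition jump w k x y :=
  x != y /\ forall i, (tnth w i + (i == y) = tnth w (i - k)%R + (i == x))%N.

Definition jumpb w k x y :=
  (x != y) &&
  [forall i, (tnth w i + (i == y) == tnth w (i - k)%R + (i == x))%N].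

Lemma jumpP w k x y : reflect (jump w k x y) (jumpb w k x y).
Proof. by apply: (iffP andP) => -[nxy /'forall_eqP]. Qed.

Definition ups w k := [set i | tnth w i && ~~ tnth w (i - k)].
Definition downs w k := [set i | ~~ tnth w i && tnth w (i - k)].

(** The ones of the rotated word are a translate of the ones of [w]; removing the common part from
    both leaves [ups] and [downs]. *)
Lemma card_ups_downs w k : #|ups w k| = #|downs w k|.
Proof.
pose S := [set i | tnth w i]; pose T := [set i | tnth w (i - k)].
have cST : #|S| = #|T|.
  rewrite -(card_imset S (addIr k)); apply: eq_card => i.
  rewrite inE; apply/imsetP/idP => [[j] | wi].
    by rewrite inE => wj ->; rewrite addrK.
  by exists (i - k); rewrite ?inE // subrK.
have -> : ups w k = S :\: T by apply/setP=> i; rewrite !inE andbC.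
have -> : downs w k = T :\: S by apply/setP=> i; rewrite !inE.
by apply/eqP; rewrite -(eqn_add2l #|S :&: T|) cardsID setIC cardsID cST.
Qed.

(** Hence all distances are even: distance 2 means one up and one down, and a nonzero distance is at
    least 2. *)
Lemma shift_distE w k : shift_dist w k = (#|ups w k|).*2.
Proof.
rewrite -addnn {2}card_ups_downs /shift_dist /hamming -cardsUI.
rewrite (_ : ups w k :&: downs w k = set0) ?cards0 ?addn0; last first.
  by apply/setP=> i; rewrite !inE; case: (tnth w i) => //; rewrite andbF.
apply: eq_card => i; rewrite !inE tnth_rotw_sub.
by case: (tnth w i); case: (tnth w _).
Qed.

Lemma shift_dist_eq2P w k : reflect (exists x y, jump w k x y) (shift_dist w k == 2).
Proof.
rewrite shift_distE -[2]/(1.*2) (inj_eq double_inj); apply: (iffP idP); last first.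
  case=> x [y [neq_xy J]]; apply/cards1P; exists x; apply/setP=> i; rewrite !inE.
  move: (J i); case: (eqVneq i x) => [->|_]; first rewrite (negPf neq_xy);
    by do 2!case: (tnth w _) => //; case: (i == y).
move=> c1; have := c1; rewrite card_ups_downs => /cards1P[y Dy].
move/cards1P: c1 => [x Ux]; exists x, y; split.
  apply/eqP=> xy; have := set11 x; rewrite -{1}Ux => xU.
  have := set11 y; rewrite -Dy -xy; move: xU; rewrite !inE.
  by case: (tnth w x).
move=> i; rewrite -!in_set1 -Ux -Dy !inE.
by case: (tnth w i); case: (tnth w _).
Qed.

Lemma jump_inj w k x y x' y' : jump w k x y -> jump w k x' y' -> x = x' /\ y = y'.
Proof.
move=> [nxy J] [nxy' J']; split.
  move: (J x) (J' x); rewrite eqxx (negPf nxy).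
  by case: (eqVneq x x') => // _; case: (x == y'); lia.
move: (J y) (J' y); rewrite eqxx eq_sym (negPf nxy).
by case: (eqVneq y y') => // _; case: (y == x'); lia.
Qed.

Lemma jump_neq0 w k x y : jump w k x y -> k != 0.
Proof.
case=> nxy J; apply/eqP => k0; move: (J x).
by rewrite k0 subr0 eqxx (negPf nxy); lia.
Qed.

(** Reading the equation at [i + k] exchanges the two ends. *)
Lemma jump_opp w k x y : jump w k x y -> jump w (- k) (y - k) (x - k).
Proof.
case=> nxy J; split; first by rewrite (inj_eq (addIr _)) eq_sym.
move=> i; rewrite opprK; have := J (i + k); rewrite addrK.
by rewrite !(eq_sym i) !subr_eq !(eq_sym _ (i + k)) => ->.
Qed.

(* The cross difference [w i - w (i-k) - w (i-j) + w (i-j-k)] is computed in two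
   ways; the two resulting formal sums of four points must agree. *)
Lemma jump2 w k j x y x' y' : jump w k x y -> jump w j x' y' ->
  [\/ j = k, j = - k, [/\ y = x + k, x' = x & y' = x + j]
    | [/\ x = y + k, y' = y & x' = y + j]].
Proof.
move=> Jk Jj; have k0 := jump_neq0 Jk; have j0 := jump_neq0 Jj.
move: Jk Jj => [nxy Jk] [nxy' Jj].
have M i : ((i == x) + (i == (y + j)%R) + (i == y') + (i == (x' + k)%R) =
            (i == y) + (i == (x + j)%R) + (i == x') + (i == (y' + k)%R))%N.
  move: (Jk i) (Jj i) (Jk (i - j)) (Jj (i - k)); rewrite !subr_eq.
  rewrite (addrAC i (- j)).
  move: (nat_of_bool (tnth w i)) (nat_of_bool (tnth w (i - k))).
  move: (nat_of_bool (tnth w (i - j))) (nat_of_bool (tnth w (i - k - j))).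
  move: (nat_of_bool (i == x)) (nat_of_bool (i == y)) (nat_of_bool (i == x')).
  move: (nat_of_bool (i == y')) (nat_of_bool (i == x + j)).
  move: (nat_of_bool (i == y + j)) (nat_of_bool (i == x' + k)).
  move: (nat_of_bool (i == y' + k)); lia.
have jF z : (z == z + j) = false.
  by rewrite -{1}(addr0 z) (inj_eq (addrI z)) eq_sym (negPf j0).
have kF z : (z == z + k) = false.
  by rewrite -{1}(addr0 z) (inj_eq (addrI z)) eq_sym (negPf k0).
have nyx' : (y' == x') = false by rewrite eq_sym (negPf nxy').
(* The point [x] occurs on the left of [M], so it occurs on the right: [x = x'] or [x = y' + k]. The
   same test at other points separates the four cases. *)
have := M x; rewrite eqxx (negPf nxy) jF.
case: (eqVneq x x') => [xx' _|_].
  have := M y'; rewrite -xx' in nyx' M *; rewrite nyx' eqxx kF.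
  case: (eqVneq y' y) => [yy' _|_].
    have := M (y + j); rewrite yy' eqxx (eq_sym _ y) jF (inj_eq (addIr j)).
    rewrite (eq_sym y x) (negPf nxy) (inj_eq (addrI y)).
    by case: (eqVneq j k) => [->|_]; [constructor 1 | lia].
  case: (eqVneq y' (x + j)) => [yx _|_]; last by lia.
  have := M y; rewrite yx eqxx (eq_sym y x) (negPf nxy) jF.
  by case: (eqVneq y (x + k)) => [->|_]; [constructor 3 | lia].
case: (eqVneq x (y' + k)) => [xy' _|_]; last by lia.
have := M y'; rewrite nyx' eqxx kF.
case: (eqVneq y' y) => [yy' _|_].
  have := M x'; rewrite eqxx kF -xy' yy' in nyx' *; rewrite (eq_sym x' y) nyx'.
  by case: (eqVneq x' (y + j)) => [->|_]; [constructor 4; rewrite xy' yy' | lia].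
case: (eqVneq y' (x + j)) => [yx _|_]; last by lia.
constructor 2; apply/eqP; rewrite -addr_eq0 -(inj_eq (addrI x)) addrA addr0.
by rewrite -yx -xy'.
Qed.
End Jumps.

(** * Periods *)

Section Periods.
Variable n : nat.
Local Notation N := n.+2.
Local Notation G := 'I_n.+2.
Implicit Types (w u v : word N) (i j k x y : G) (t : nat).

(** A period is a natural number, read modulo [N], so that the periods of a word can be described by
    divisibility ([periodE]). *)
Definition period t u := [forall i, tnth u (i - t%:R) == tnth u i].

Lemma periodP t u : reflect (forall i, tnth u (i - t%:R) = tnth u i) (period t u).
Proof. exact: 'forall_eqP. Qed.

Lemma natrN0 : N%:R = 0 :> G.
Proof. by rewrite Zp_nat; apply: val_inj; rewrite /= modnn. Qed.

Lemma periodN u : period N u.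
Proof. by apply/periodP => i; rewrite natrN0 subr0. Qed.

Lemma periodD a b u : period b u -> period (a + b) u = period a u.
Proof.
move/periodP => pb; apply/periodP/periodP => pa i.
  by rewrite -pb -addrA -opprD -natrD pa.
by rewrite natrD opprD addrA pb pa.
Qed.

Lemma periodM c t u : period t u -> period (c * t) u.
Proof.
move=> pt; elim: c => [|c IHc]; first by apply/periodP => i; rewrite subr0.
by rewrite mulSn addnC periodD.
Qed.

(** By Bezout, [gcdn a b] plus a multiple of [b] is a multiple of [a]. *)
Lemma period_gcd a b u : period a u -> period b u -> period (gcdn a b) u.
Proof.
case: (posnP a) => [-> | a_gt0 pa pb]; first by rewrite gcd0n.
have [c _ /dvdnP[d E]] := Bezoutl b a_gt0.
by rewrite -(periodD _ (periodM c pb)) E periodM.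
Qed.

Fact min_period_ex u : exists t, (0 < t)%N && period t u.
Proof. by exists N; rewrite periodN. Qed.

Definition min_period u := ex_minn (min_period_ex u).

(** Periods are closed under gcd, so the least positive one divides them all. *)
Lemma periodE t u : period t u = (min_period u %| t)%N.
Proof.
rewrite /min_period; case: ex_minnP => m /andP[m_gt0 pm] min_m.
apply/idP/idP => [pt|/dvdnP[c ->]]; last exact: periodM.
case: (posnP t) => [->|t_gt0]; first exact: dvdn0.
have := min_m (gcdn m t); rewrite gcdn_gt0 m_gt0 period_gcd //= => /(_ isT) le_m.
have/eqP <- : gcdn m t == m by rewrite eqn_leq le_m dvdn_leq ?dvdn_gcdl.
exact: dvdn_gcdr.
Qed.

Lemma min_period_dvd u : (min_period u %| N)%N.
Proof. by rewrite -periodE periodN. Qed.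

Lemma period_gcdN t u : period (gcdn N t) u = period t u.
Proof. by rewrite !periodE dvdn_gcd min_period_dvd. Qed.

Lemma period_mod t u i : period t u -> tnth u (i %% t)%:R = tnth u i.
Proof.
move=> pt; have /periodP/(_ i) <- := periodM (i %/ t) pt.
congr tnth; apply/eqP.
by rewrite eq_sym subr_eq addrC -natrD -divn_eq natr_Zp.
Qed.

(** A word of period [t] is the repetition [ext v] of its first [t] letters. *)
Lemma card_period t : (t %| N)%N -> #|[set u : word N | period t u]| = (2 ^ t)%N.
Proof.
move=> tN; have t_gt0 : (0 < t)%N by apply: dvdn_gt0 tN.
pose ext (v : t.-tuple bool) : word N := [tuple nth false v (i %% t) | i < N].
rewrite -card_bool -card_tuple -(card_imset predT (f := ext)); last first.
  move=> v1 v2 E; apply: eq_from_tnth => c.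
  have cN : (c < N)%N by apply: leq_trans (ltn_ord c) _; rewrite dvdn_leq.
  move/(congr1 (fun u => tnth u (Ordinal cN))): E; rewrite !tnth_mktuple /=.
  by rewrite modn_small // !(tnth_nth false).
apply: eq_card => u; rewrite inE; apply/idP/imsetP => [pu | [v _ ->]].
  exists [tuple tnth u (c%:R) | c < t] => //; apply: eq_from_tnth => i.
  have im : (i %% t < t)%N by rewrite ltn_mod.
  rewrite tnth_mktuple -[(_ %% _)%N]/(nat_of_ord (Ordinal im)) -tnth_nth.
  by rewrite tnth_mktuple period_mod.
apply/periodP => i; rewrite !tnth_mktuple; congr nth.
rewrite -[in RHS](subrK t%:R i); move: (i - t%:R) => j.
by rewrite Zp_nat /= modnDmr modn_dvdm // modnDr.
Qed.

(** Sorting the [2 ^ e] words of period [e] by their minimal period, a divisor of [e], gives the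
    hypothesis of the Moebius inversion. *)
Lemma prim_wordsE t : (t %| N)%N ->
  prim_words t = #|[set u : word N | min_period u == t]|%:R.
Proof.
move=> tN; have t_gt0 : (0 < t)%N by apply: dvdn_gt0 tN.
rewrite -(prim_words_inversion (f := fun t =>
  #|[set u : word N | min_period u == t]|%:R) t_gt0) // => e et.
have e_gt0 : (0 < e)%N by apply: dvdn_gt0 et.
rewrite -natr_sum -natrX -card_period ?(dvdn_trans et) //; congr _%:R.
under eq_bigr do rewrite -sum1dep_card big_mkcond.
rewrite exchange_big /= -sum1dep_card [RHS]big_mkcond; apply: eq_bigr => u _.
rewrite periodE dvdn_divisors // -big_mkcond /= sum1_count.
rewrite (eq_count (a2 := pred1 (min_period u))) => [|d]; last exact: eq_sym.
by rewrite count_uniq_mem ?divisors_uniq //; case: (_ \in _).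
Qed.
End Periods.

(** * Words with a given shift at distance two *)

Section Arcs.
Variable n : nat.
Local Notation N := n.+2.
Local Notation G := 'I_n.+2.
Implicit Types (w u v : word N) (i j k x y : G) (a t : nat).

(** The additive order of [k] in Z/N; see [mulrn_Zp_eq0]. *)
Definition ordz k := (N %/ gcdn N k)%N.

Lemma ordz_gt0 k : (0 < ordz k)%N.
Proof. by rewrite divn_gt0 ?gcdn_gt0 // dvdn_leq ?dvdn_gcdl. Qed.

Lemma mulrn_Zp_eq0 k a : (k *+ a == 0) = (ordz k %| a)%N.
Proof.
rewrite Zp_mulrn -val_eqE /= -[_ == 0]/(N %| k * a)%N /ordz.
set g := gcdn N k; have g_gt0 : (0 < g)%N by rewrite gcdn_gt0.
have Ng := divnK (dvdn_gcdl N k); have kg := divnK (dvdn_gcdr N k).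
rewrite -[X in (X %| _)%N]Ng -[X in (_ %| X * _)%N]kg mulnAC.
rewrite dvdn_pmul2r // Gauss_dvdr //.
by rewrite /coprime -(eqn_pmul2r g_gt0) muln_gcdl Ng kg mul1n.
Qed.

Lemma mulrn_Zp_inj k : {in [pred a | a < ordz k]%N &, injective (fun a => k *+ a)}.
Proof.
have W a b : (a <= b < ordz k)%N -> k *+ a = k *+ b -> a = b.
  case/andP=> le_ab lt_b E; have : k *+ (b - a) == 0 by rewrite mulrnBr // E subrr.
  rewrite mulrn_Zp_eq0; case: (posnP (b - a)) => [|p]; first by lia.
  by move=> /(dvdn_leq p); lia.
move=> a b; rewrite !inE => la lb /= E; case: (leqP a b) => ab.
  by apply: W E; rewrite ab.
by apply/esym; apply: (W _ _ _ (esym E)); rewrite ltnW.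
Qed.

(** The cyclic interval [x, x + k, ..., x + (a - 1) k] in the coset of [x] modulo the subgroup
    generated by [k]. *)
Definition arc k x a i := [exists t : 'I_a, i == x + k *+ t].

Lemma arc_orbit k x a t : (a <= ordz k)%N -> (t < ordz k)%N ->
  arc k x a (x + k *+ t) = (t < a)%N.
Proof.
move=> le_a lt_t; apply/existsP/idP => [[s] | lt_ta]; last by exists (Ordinal lt_ta).
rewrite (inj_eq (addrI x)) => /eqP/mulrn_Zp_inj -> //; rewrite inE //.
exact: leq_trans (ltn_ord s) le_a.
Qed.

(** Along the coset of [x] the indicator of the arc rises at [x] and falls at [x + k *+ a]; off the
    coset all four terms vanish. *)
Lemma arc_step k x a i : (0 < a < ordz k)%N ->
  (arc k x a i + (i == (x + k *+ a)%R) = arc k x a (i - k)%R + (i == x))%N.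
Proof.
case/andP=> a_gt0 lt_a; have le_a := ltnW lt_a.
have [t /= /eqP -> | noti] := pickP (fun t : 'I_(ordz k) => i == x + k *+ t).
  have lt_t := ltn_ord t; rewrite arc_orbit // (inj_eq (addrI x)).
  rewrite (inj_in_eq (@mulrn_Zp_inj k)) ?inE //.
  have -> : (x + k *+ t == x) = (t == 0 :> nat).
    rewrite -[X in _ == X]addr0 (inj_eq (addrI x)) mulrn_Zp_eq0.
    by rewrite /dvdn modn_small.
  case: t lt_t => [[|t] /= _] lt_t.
    (* The predecessor of [x] is the last point of its coset, which the arc misses because
       [a < ordz k]. *)
    have -> : x + k *+ 0 - k = x + k *+ (ordz k).-1.
      apply/eqP; rewrite mulr0n addr0 subr_eq -addrA -mulrSr prednK ?ordz_gt0 //.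
      have /eqP -> : k *+ ordz k == 0 by rewrite mulrn_Zp_eq0.
      by rewrite addr0.
    rewrite arc_orbit ?prednK ?ordz_gt0 //; lia.
  rewrite mulrSr addrA addrK arc_orbit ?(ltnW lt_t) //; lia.
have F t : (t < ordz k)%N -> (i == x + k *+ t) = false.
  by move=> lt_t; apply: (noti (Ordinal lt_t)).
have -> : arc k x a i = false.
  by apply/existsP=> -[t]; rewrite F // (leq_trans (ltn_ord t)).
have -> : arc k x a (i - k) = false.
  apply/existsP=> -[t]; rewrite subr_eq -addrA -mulrSr F //.
  by rewrite (leq_ltn_trans (ltn_ord t)).
by rewrite F // -[x in _ == x]addr0 -(mulr0n k) F // ordz_gt0.
Qed.

(** The letter is 1 at [x] and 0 at [x - k]. Walking from [x] in steps of [k], the first zero comes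
    right after a one, so it is the fall [y]; it is reached before the walk closes up. *)
Lemma jump_arc w k x y : jump w k x y ->
  exists2 a, (0 < a < ordz k)%N & y = x + k *+ a.
Proof.
case=> nxy J; have := J x; rewrite eqxx (negPf nxy) addn0.
case wx: (tnth w x) => //; last by lia.
case wxk: (tnth w (x - k)) => // _.
have ordk : k *+ (ordz k).-1 = - k.
  apply/eqP; rewrite -addr_eq0 -mulrSr prednK ?ordz_gt0 // mulrn_Zp_eq0.
  exact: dvdnn.
have ex : exists a, ~~ tnth w (x + k *+ a).
  by exists (ordz k).-1; rewrite ordk wxk.
case: (ex_minnP ex) => a wa min_a; exists a.
  have := min_a (ordz k).-1; rewrite ordk wxk => /(_ isT).
  have := ordz_gt0 k; case: a wa min_a => [|a _ _]; last by lia.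
  by rewrite mulr0n addr0 wx.
case: a wa min_a => [|a] wa min_a; first by rewrite mulr0n addr0 wx in wa.
have wa' : tnth w (x + k *+ a) by apply/negPn/negP => /min_a; rewrite ltnn.
have xk : x + k *+ a.+1 - k = x + k *+ a by rewrite mulrSr addrA addrK.
have := J (x + k *+ a.+1); rewrite xk wa' (negPf wa).
by case: (eqVneq _ y) => // _; lia.
Qed.

(** By [jump_arc], a word at distance 2 from its shift by [k] lies in [arcs k a] for some
    [0 < a < ordz k]. *)
Definition arcs k a := [set w : word N | [exists x, jumpb w k x (x + k *+ a)]].

(* Every [w] in [arcs k a] is [xor_arc k a (x, u)] for exactly one pair with
   [u] of period [k] and zero at [x]. *)
Definition xor_arc k a (p : G * word N) : word N :=
  [tuple tnth p.2 i (+) arc k p.1 a i | i < N].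

(** Having period [k] and a zero at [x], [u] vanishes on the whole coset of [x]. The xor therefore
    just inserts the arc, and [arc_step] gives the jump. *)
Lemma xor_arc_jump k a x u : (0 < a < ordz k)%N -> period k u -> ~~ tnth u x ->
  jump (xor_arc k a (x, u)) k x (x + k *+ a).
Proof.
move=> ak /periodP pu ux; have k_gt0 := ordz_gt0 k.
have uX t : tnth u (x + k *+ t) = false.
  elim: t => [|t <-]; first by rewrite mulr0n addr0 (negPf ux).
  by rewrite -(pu (x + _)) natr_Zp mulrSr addrA addrK.
split.
  rewrite -[x in x != _]addr0 (inj_eq (addrI x)) eq_sym mulrn_Zp_eq0.
  by case/andP: ak => a_gt0 ltak; rewrite gtnNdvd.
move=> i; have := arc_step x i ak; rewrite !tnth_mktuple /=.
have := pu i; rewrite natr_Zp => ->; case ui: (tnth u i) => //=.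
have arcF j : tnth u j -> arc k x a j = false.
  by move=> uj; apply/existsP => -[t /eqP E]; rewrite E uX in uj.
rewrite !arcF //; last by rewrite -[k]natr_Zp pu.
have -> : (i == x + k *+ a) = false by apply/eqP => E; rewrite E uX in ui.
suff -> : (i == x) = false by [].
by apply/eqP => E; rewrite -[i]addr0 -(mulr0n k) E uX in ui.
Qed.

(** The arc makes the same jump as [w], so removing it leaves a word of period [k]. *)
Lemma jump_xor_arc w k a x : (0 < a < ordz k)%N -> jump w k x (x + k *+ a) ->
  exists u, [/\ period k u, ~~ tnth u x & w = xor_arc k a (x, u)].
Proof.
move=> ak [nxy J]; exists (xor_arc k a (x, w)); split.
- apply/periodP => i; rewrite natr_Zp !tnth_mktuple /=.
  move: (J i) (arc_step x i ak).
  by do 2!case: (tnth w _); do 2!case: (arc _ _ _ _); do 2!case: (i == _).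
- rewrite tnth_mktuple /= -[X in arc _ _ _ X]addr0 -(mulr0n k).
  rewrite arc_orbit ?ordz_gt0 //; last by case/andP: ak => _ /ltnW.
  case/andP: ak => -> _; have := J x; rewrite eqxx (negPf nxy).
  by case: (tnth w x) => //; lia.
by apply: eq_from_tnth => i; rewrite !tnth_mktuple /= -addbA addbb addbF.
Qed.

(** Complementing all letters preserves the period and exchanges the values 0 and 1 at [x], so
    exactly half of the words of period [k] are counted. *)
Lemma card_period_false k x :
  #|[set u : word N | period k u && ~~ tnth u x]| = (2 ^ (gcdn N k).-1)%N.
Proof.
set A := [set u | _]; pose ng u : word N := [tuple ~~ tnth u i | i < N].
have ngK : involutive ng.
  by move=> u; apply: eq_from_tnth => i; rewrite !tnth_mktuple negbK.
have period_ng u : period k (ng u) = period k u.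
  apply: eq_forallb => i; rewrite !tnth_mktuple.
  by case: (tnth u i); case: (tnth u _).
have cA : #|[set u : word N | period k u]| = (#|A| + #|A|)%N.
  rewrite -{2}(card_imset A (inv_inj ngK)).
  rewrite -(cardsID A); congr (_ + _)%N; apply: eq_card => u; rewrite !inE.
    by case: (period k u).
  apply/andP/imsetP => [[] | [v + ->]].
    rewrite negb_and => /orP[/negPf-> // | ux] pu.
    by exists (ng u); rewrite ?ngK // inE period_ng pu tnth_mktuple.
  rewrite inE => /andP[pv vx]; rewrite period_ng pv tnth_mktuple.
  by rewrite vx.
have g_gt0 : (0 < gcdn N k)%N by rewrite gcdn_gt0.
apply: double_inj; rewrite -addnn -cA -mul2n -expnS prednK //.
rewrite -(@card_period n) ?dvdn_gcdl //.
by apply: eq_card => u; rewrite !inE period_gcdN.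
Qed.

(** There are [N] choices of the start [x], then [u] is counted by [card_period_false]. The word
    determines [x] by [jump_inj], and then [u] by removing the arc. *)
Lemma card_arcs k a : (0 < a < ordz k)%N ->
  #|arcs k a| = (N * 2 ^ (gcdn N k).-1)%N.
Proof.
move=> ak.
pose B := [set p : G * word N | period k p.2 && ~~ tnth p.2 p.1].
have -> : arcs k a = [set xor_arc k a p | p in B].
  apply/setP=> w; rewrite inE; apply/existsP/imsetP => [[x /jumpP J] | [[x u]]].
    have [u [pu ux ->]] := jump_xor_arc ak J.
    by exists (x, u); rewrite ?inE ?pu.
  rewrite inE /= => /andP[pu ux] ->; exists x; apply/jumpP.
  exact: xor_arc_jump.
rewrite card_in_imset => [|[x u] [y v]]; last first.
  rewrite !inE /= => /andP[pu ux] /andP[pv vy] E.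
  have J1 := xor_arc_jump ak pu ux; have J2 := xor_arc_jump ak pv vy.
  rewrite E in J1; have [xy _] := jump_inj J1 J2; rewrite -xy in E *.
  congr (_, _); apply: eq_from_tnth => i.
  have := congr1 (fun w => tnth w i) E; rewrite !tnth_mktuple /=.
  exact: addIb.
rewrite -sum1dep_card.
rewrite -(pair_big_dep xpredT (fun x u => period k u && ~~ tnth u x)
  (fun _ _ => 1%N)) /=.
under eq_bigr do rewrite sum1dep_card card_period_false.
by rewrite sum_nat_const card_ord.
Qed.
End Arcs.

(** * Shapes of K2 *)

Section Classification.
Variable n : nat.
Local Notation N := n.+2.
Local Notation G := 'I_n.+2.
Implicit Types (w u v : word N) (i j k x y : G) (a t : nat).

Lemma K2_wordP w j : reflect (exists x y, jump w j x y) (j \in K2_word w).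
Proof.
rewrite inE; apply: (iffP andP) => [[_ /shift_dist_eq2P]//|ex]; split.
  by have [x [y /jump_neq0]] := ex; rewrite lt0n.
exact/shift_dist_eq2P.
Qed.

Definition flip x u : word N := [tuple tnth u i (+) (i == x) | i < N].

Lemma flipK x : involutive (flip x).
Proof.
move=> u; apply: eq_from_tnth => i.
by rewrite !tnth_mktuple -addbA addbb addbF.
Qed.

(** This is the case [a = 1]: the arc is the single point [x], and flipping it restores the period.
    [period_flip_down] treats the complementary case of a single zero on the coset. *)
Lemma period_flip_up w j x : jump w j x (x + j) -> period j (flip x w).
Proof.
case=> _ J; apply/periodP => i; rewrite natr_Zp !tnth_mktuple; move: (J i).
by rewrite subr_eq; do 2!case: (tnth w _); do 2!case: (i == _).
Qed.

Lemma period_flip_down w j x : jump w j (x + j) x -> period j (flip x w).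
Proof.
case=> _ J; apply/periodP => i; rewrite natr_Zp !tnth_mktuple; move: (J i).
by rewrite subr_eq; do 2!case: (tnth w _); do 2!case: (i == _).
Qed.

(** The letter of [w] at [x] decides the direction of the jump. *)
Lemma jump_flip w j x : j != 0 -> period j (flip x w) ->
  jump w j x (x + j) \/ jump w j (x + j) x.
Proof.
move=> j0 /periodP pv; have xj : (x == x + j) = false.
  by rewrite -{1}(addr0 x) (inj_eq (addrI x)) eq_sym (negPf j0).
have P i : tnth w (i - j) (+) (i == x + j) = tnth w i (+) (i == x).
  by have := pv i; rewrite natr_Zp !tnth_mktuple subr_eq.
have Px := P x; have := P (x + j); rewrite !eqxx xj (eq_sym _ x) xj addrK in Px *.
rewrite !addbF in Px *.
case wx: (tnth w x) Px => Px Pj; [left | right]; split;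
  rewrite ?(eq_sym _ x) ?xj // => i.
  case: (eqVneq i x) => [->|ix]; first by rewrite wx xj Px.
  case: (eqVneq i (x + j)) => [->|ixj]; first by rewrite addrK wx -Pj.
  by have := P i; rewrite (negPf ix) (negPf ixj) !addbF => ->.
case: (eqVneq i x) => [->|ix]; first by rewrite wx xj Px.
case: (eqVneq i (x + j)) => [->|ixj]; first by rewrite addrK wx -Pj.
by have := P i; rewrite (negPf ix) (negPf ixj) !addbF => ->.
Qed.

Lemma period_opp u k : period (- k)%R u = period k u.
Proof.
apply/periodP/periodP => pu i; rewrite natr_Zp.
  by rewrite -(pu (i - k)) natr_Zp opprK subrK.
by rewrite opprK -(pu (i + k)) natr_Zp addrK.
Qed.

(** The shift [t] itself is at distance 2, so any other such shift [j] can be compared with it by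
    [jump2]. Either [j] is [t] or [- t], or its jump has an end at [x] that makes [j] a period of
    the flipped word; the remaining case would give [2 t = 0] in Z/N. *)
Lemma K2_flip w x (t := min_period (flip x w)) : (t.*2 < N)%N ->
  K2_word w = [set j : G | (0 < j)%N && (t %| j)%N].
Proof.
move=> lt2t; have t_gt0 : (0 < t)%N by apply: dvdn_gt0 (min_period_dvd _).
have tN : (t < N)%N by lia.
pose k : G := Ordinal tN.
have pk : period k (flip x w) by rewrite periodE dvdnn.
have k0 : k != 0 by rewrite -val_eqE /= -lt0n.
have kk0 : (k + k == 0) = false.
  by rewrite -val_eqE /= addnn modn_small //; case: (t) t_gt0.
have xkk z : z = z + k + k -> False.
  by move/eqP; rewrite -addrA -{1}[z]addr0 (inj_eq (addrI z)) eq_sym kk0.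
apply/setP=> j; apply/K2_wordP/idP => [[x' [y' Jj]]|]; last first.
  rewrite inE -periodE lt0n => /andP[j0 /jump_flip]; move/(_ j0).
  by case=> J; do 2!eexists; apply: J.
have j0 := jump_neq0 Jj; rewrite inE lt0n -[_ != 0%N]/(j != 0) j0 /= -periodE.
case: (jump_flip k0 pk) => Jk; case: (jump2 Jk Jj) => [-> // | -> | [] | []].
- by rewrite period_opp.
- by move=> _ xx yx; rewrite xx yx in Jj; apply: period_flip_up.
- by move/xkk.
- by rewrite period_opp.
- by move/xkk.
- by move=> _ yy xy; rewrite yy xy in Jj; apply: period_flip_down.
Qed.

Definition half_shift : G := inord (N %/ 2).

Lemma half_shift_val : half_shift = (N %/ 2)%N :> nat.
Proof. by rewrite inordK //; lia. Qed.

Lemma isHT_K2 w : isHT (K2_word w) = (2 %| N)%N && (half_shift \in K2_word w).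
Proof.
rewrite /isHT; congr (_ && _); apply/existsP/idP => [[k /andP[kK /eqP kE]]|hK].
  by rewrite (_ : half_shift = k) //; apply: val_inj; rewrite [LHS]half_shift_val -kE.
by exists half_shift; rewrite hK half_shift_val eqxx.
Qed.

(** The arcs with [2 <= a <= ordz k - 2], for which [jump2] allows only the shifts [k] and [- k]. *)
Definition generic : {set word N} :=
  [set w | [exists k : G, exists a : 'I_N,
     [&& 1 < a, a.+1 < ordz k & w \in arcs k a]%N]].

(** The words of minimal period [t] with one letter flipped. *)
Definition defects t : {set word N} :=
  [set w | [exists x, min_period (flip x w) == t]].

Lemma ordz_le k : (ordz k <= N)%N.
Proof. exact: leq_div. Qed.

(** The last two cases of [jump2] would give [a = 1] or [(a + 1) k = 0], which the bounds on [a]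
    exclude. *)
Lemma K2_generic w k x a : (1 < a)%N -> (a.+1 < ordz k)%N ->
  jump w k x (x + k *+ a) -> K2_word w = [set k; - k].
Proof.
move=> a_gt1 lt_a J; apply/setP=> j; rewrite in_set2.
apply/K2_wordP/orP => [[x' [y' Jj]] | ].
  case: (jump2 J Jj) => [->|->|[E _ _]|[E _ _]]; rewrite ?eqxx; auto.
    have : k *+ a = k *+ 1 by apply: (addrI x); rewrite E mulr1n.
    by move/mulrn_Zp_inj; rewrite !inE => W; have := W ltac:(lia) ltac:(lia); lia.
  have : k *+ a.+1 = k *+ 0.
    by apply: (addrI x); rewrite mulrSr addrA -E mulr0n addr0.
  by move/mulrn_Zp_inj; rewrite !inE => W; have := W ltac:(lia) ltac:(lia); lia.
case=> /eqP->; first by do 2!eexists; apply: J.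
by do 2!eexists; apply: jump_opp J.
Qed.

Lemma K2_cases w : K2_word w != set0 ->
  [\/ isHT (K2_word w), w \in generic
    | exists x, (min_period (flip x w)).*2 < N]%N.
Proof.
case/set0Pn => k kK; have [x [y J]] := K2_wordP _ _ kK; have k0 := jump_neq0 J.
have [a /andP[a_gt0 lt_a] ya] := jump_arc J.
have D z : period k (flip z w) -> [\/ isHT (K2_word w), w \in generic
    | exists x, (min_period (flip x w)).*2 < N]%N.
  set t := min_period (flip z w) => pk.
  have t_gt0 : (0 < t)%N by apply: dvdn_gt0 (min_period_dvd _).
  have tk : (t <= k)%N by rewrite dvdn_leq -?periodE // lt0n.
  have tN := leq_ltn_trans tk (ltn_ord k).
  have [c Nc] := dvdnP (min_period_dvd (flip z w)); rewrite -/t in Nc.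
  have := tN; rewrite [X in (_ < X)%N]Nc.
  case: c Nc => [|[|[|c]]] Nc; rewrite ?mul0n ?mul1n ?ltnn // => _.
    constructor 1; rewrite isHT_K2 [X in (_ %| X)%N]Nc dvdn_mulr //=.
    have hE : half_shift = t :> nat by rewrite half_shift_val Nc mulKn.
    have h0 : half_shift != 0 by rewrite -val_eqE /= hE -lt0n.
    have : period half_shift (flip z w) by rewrite hE periodE.
    by case/(jump_flip h0) => J'; apply/K2_wordP; do 2!eexists; apply: J'.
  constructor 3; exists z; rewrite -/t [X in (_ < X)%N]Nc; nia.
case: (ltngtP a 1) => [|a_gt1|a1]; first by lia.
  case: (ltngtP a.+1 (ordz k)) => [lta|gta|aE]; last 2 first.
  - by lia.
  (* When [a + 1 = ordz k], the only zero on the coset is [y], and [y + k = x]. *)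
  - apply: (D y); apply: period_flip_down.
    rewrite (_ : y + k = x) // ya -addrA -mulrSr aE.
    by apply/eqP; rewrite -subr_eq0 addrAC subrr add0r mulrn_Zp_eq0.
  constructor 2.
  rewrite inE; apply/existsP; exists k; apply/existsP.
    have aN : (a < N)%N by apply: leq_trans lt_a (ordz_le k).
    exists (Ordinal aN); rewrite a_gt1 lta inE /=.
    by apply/existsP; exists x; apply/jumpP; rewrite -ya.
by apply: (D x); apply: period_flip_up; rewrite -[X in x + X]mulr1n -a1 -ya.
Qed.

(** The pair [(x, u)] is determined by [flip x u]: if two pairs with [x != y] gave the same word,
    the set [{x, y}] would be invariant under translation by [t], forcing [y = x + t], [x = y + t]
    and [2 t = 0]. *)
Lemma card_defects t : (t.*2 < N)%N ->
  #|defects t| = (N * #|[set u : word N | min_period u == t]|)%N.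
Proof.
move=> lt2t.
pose A := [set u : word N | min_period u == t].
have -> : defects t = [set flip p.1 p.2 | p in setX [set: G] A].
  apply/setP=> w; rewrite inE; apply/existsP/imsetP => [[x mx] | [[x u]]].
    by exists (x, flip x w); rewrite ?inE //= flipK.
  by rewrite !inE /= => mu ->; exists x; rewrite flipK.
rewrite card_in_imset ?cardsX ?cardsT ?card_ord // => -[x u] [y v].
rewrite !inE /= => /eqP mu /eqP mv E.
case: (eqVneq x y) => [xy|nxy].
  by rewrite -xy; congr (_, _); rewrite -(flipK x u) E -xy flipK.
have t_gt0 : (0 < t)%N by rewrite -mu; apply: dvdn_gt0 (min_period_dvd _).
have tN : (t < N)%N by lia.
pose k : G := Ordinal tN.
have k0 : k != 0 by rewrite -val_eqE /= -lt0n.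
have kk0 : (k + k == 0) = false.
  by rewrite -val_eqE /= addnn modn_small //; case: (t) t_gt0.
have /periodP pu : period k u by rewrite periodE mu.
have /periodP pv : period k v by rewrite periodE mv.
have P i : (i == x) (+) (i == y) = (i == x + k) (+) (i == y + k).
  have F j := congr1 (fun w => tnth w j) E.
  move: (F i) (F (i - k)) (pu i) (pv i); rewrite !tnth_mktuple natr_Zp !subr_eq.
  by do 2![case: (tnth _ (i - k)); case: (tnth _ i)]; do 4!case: (i == _).
have kF z : (z == z + k) = false.
  by rewrite -{1}(addr0 z) (inj_eq (addrI z)) eq_sym (negPf k0).
have := P x; have := P y; rewrite !eqxx !kF (eq_sym y x) (negPf nxy) /=.
case: (eqVneq y (x + k)) => // -> _; case: eqP => // /esym/eqP.
by rewrite -subr_eq0 addrC !addrA addNr add0r kk0.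
Qed.

Lemma ordz_opp k : ordz (- k) = ordz k.
Proof.
have W j : (ordz (- j) %| ordz j)%N.
  by rewrite -mulrn_Zp_eq0 mulNrn oppr_eq0 mulrn_Zp_eq0.
by apply/eqP; rewrite eqn_dvd W -{1}(opprK k) W.
Qed.

(** Double counting of the triples of a word [w] and a pair [(k, a)] describing it. *)
Lemma card_generic :
  (#|generic|.*2 =
    N * \sum_(k : G) (ordz k - 3) * 2 ^ (gcdn N k).-1)%N.
Proof.
pose good (p : G * 'I_N) := (1 < p.2)%N && (p.2.+1 < ordz p.1)%N.
(* a generic word has exactly two descriptions, by [k] and by [- k] *)
transitivity (\sum_(w : word N) \sum_(p | good p) (w \in arcs p.1 p.2))%N.
  rewrite -muln2 -sum_nat_const [LHS]big_mkcond; apply: eq_bigr => w _.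
  rewrite -big_mkcondr sum1dep_card; case: ifP => [|/negbT Nw]; last first.
    apply/esym/eqP; rewrite cards_eq0; apply/eqP/setP=> -[k a]; rewrite !inE.
    apply: contraNF Nw => /andP[/andP[/= a1 a2] wa].
    rewrite inE; apply/existsP; exists k; apply/existsP; exists a.
    by rewrite a1 a2 inE.
  rewrite inE => /existsP[k /existsP[a /and3P[a1 a2]]].
  rewrite inE => /existsP[x /jumpP J].
  have K2w := K2_generic a1 a2 J.
  (* Traversed backwards, the same arc starts at its last point [x + k *+ a - k] and keeps its
     length [a]. *)
  have Jn : jump w (- k) (x + k *+ a - k) (x + k *+ a - k + (- k) *+ a).
    have -> : x + k *+ a - k + (- k) *+ a = x - k by rewrite mulNrn addrAC addrK.
    exact: jump_opp.
  (* Otherwise the order of [k] would divide 2, whereas it exceeds 3. *)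
  have kNk : k != - k.
    rewrite -addr_eq0 -mulr2n mulrn_Zp_eq0; apply/negP => /dvdn_leq; lia.
  have uniq_a (c : G) (z : G) (b : 'I_N) : ordz c = ordz k ->
      jump w c z (z + c *+ a) -> (b.+1 < ordz c)%N -> w \in arcs c b -> b = a.
    move=> oc Ja b2; rewrite inE => /existsP[z' /jumpP Jb].
    have [<-] := jump_inj Ja Jb; move/addrI/mulrn_Zp_inj; rewrite !inE oc => W.
    by apply/val_inj/esym/W; lia.
  transitivity #|[set (k, a); (- k, a)]|.
    by rewrite cards2 xpair_eqE (negPf kNk).
  apply: eq_card => -[c b]; rewrite !inE !xpair_eqE /=.
  apply/orP/andP => [[] /andP[/eqP-> /eqP->] | [/andP[/= b1 b2] wb]].
  - by rewrite /good /= a1 a2; split=> //; apply/existsP; exists x; apply/jumpP.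
  - rewrite /good /= ordz_opp a1 a2; split=> //; apply/existsP.
    by exists (x + k *+ a - k); apply/jumpP.
  have : c \in K2_word w.
    by have [z /jumpP Jc] := existsP wb; apply/K2_wordP; do 2!eexists; apply: Jc.
  have wb' : w \in arcs c b by rewrite inE.
  rewrite K2w in_set2 => /orP[/eqP cE | /eqP cE]; rewrite cE eqxx in b2 wb' *.
    by left; rewrite (uniq_a _ _ _ _ J b2 wb') ?eqxx.
  by right; rewrite (uniq_a _ _ _ (ordz_opp k) Jn b2 wb') eqxx.
rewrite exchange_big big_distrr /=.
rewrite -(pair_big_dep xpredT (fun (k : G) (a : 'I_N) => good (k, a))
  (fun (k : G) (a : 'I_N) => \sum_(w : word N) (w \in arcs k a))%N) /=.
apply: eq_bigr => k _.
rewrite (eq_bigr (fun=> N * 2 ^ (gcdn N k).-1)%N) => [|a];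
  last case/andP=> /= a1 a2; last first.
  by rewrite -big_mkcond sum1_card card_arcs //; lia.
rewrite /good /= -(big_mkord (fun a => (1 < a)%N && (a.+1 < ordz k)%N)
  (fun=> N * 2 ^ (gcdn N k).-1)%N).
have oN := ordz_le k.
(* The range [2 <= a < ordz k - 1] has [ordz k - 3] elements, the truncated difference being 0 for
   orders up to 3. *)
rewrite (eq_bigl (fun a => (1 < a)%N && (a < (ordz k).-1)%N)) => [|a]; last first.
  by rewrite ltn_predRL.
rewrite -(big_nat_widen _ (ordz k).-1 _ (fun a => 1 < a)%N); last by lia.
rewrite (eq_bigl (fun a => xpredT a && (2 <= a)%N)) // -big_nat_widenl //.
rewrite sum_nat_const_nat; lia.
Qed.
End Classification.

(** * From words to necklaces *)

Section Counting.
Variable n : nat.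
Local Notation N := n.+2.
Local Notation G := 'I_n.+2.
Implicit Types (w u v : word N) (i j k x y : G) (a t : nat).

Lemma gcdn_ordz k : gcdn N k = (N %/ ordz k)%N.
Proof. by rewrite /ordz divnA ?dvdn_gcdl // mulKn. Qed.

(** With [g = N / m], the elements of order [m] are the [g * c] with [c < m] prime to [m]. *)
Lemma card_ordz m : (m %| N)%N -> #|[set k : G | ordz k == m]| = totient m.
Proof.
move=> mN; have m_gt0 : (0 < m)%N by apply: dvdn_gt0 mN.
have [g Ng] := dvdnP mN; have g_gt0 : (0 < g)%N by case: g Ng.
pose f (c : 'I_m) : G := inord (g * c).
have fE c : f c = (g * c)%N :> nat.
  by rewrite inordK // [X in (_ < X)%N]Ng ltn_pmul2l.
have f_inj : injective f.
  move=> b c /(congr1 (@nat_of_ord N)); rewrite !fE => /eqP.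
  by rewrite eqn_pmul2l // => /eqP/val_inj.
have ordf c : (ordz (f c) == m) = coprime m c.
  rewrite /ordz fE [X in (X %/ _)%N]Ng [X in gcdn X]Ng -muln_gcdr.
  rewrite divnMl // /coprime; apply/eqP/eqP => [E|->]; last exact: divn1.
  have := divnK (dvdn_gcdl m c); rewrite E; move: m_gt0; clear; nia.
rewrite totient_count_coprime big_mkord -big_mkcond sum1dep_card -(card_imset _ f_inj).
apply: eq_card => k; rewrite inE; apply/idP/imsetP => [/eqP mk | [c]]; last first.
  by rewrite inE => + ->; rewrite ordf.
have gk : (g %| k)%N.
  apply: dvdn_trans (dvdn_gcdr N k); rewrite gcdn_ordz mk.
  by rewrite [X in (X %/ _)%N]Ng mulnK.
have lt_kg : (k %/ g < m)%N by rewrite ltn_divLR // mulnC -Ng.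
have fk : f (Ordinal lt_kg) = k by apply: val_inj; rewrite [LHS]fE /= mulnC divnK.
by exists (Ordinal lt_kg); rewrite // inE -ordf fk mk.
Qed.

Lemma sum_ordz (F : nat -> nat) :
  (\sum_(k : G) F (ordz k) = \sum_(m <- divisors N) totient m * F m)%N.
Proof.
transitivity (\sum_(k : G) \sum_(m <- divisors N | ordz k == m) F m)%N.
  apply: eq_bigr => k _; rewrite big_mkcond (bigD1_seq (ordz k)) ?divisors_uniq //=.
    by rewrite eqxx big1 ?addn0 // => m /negPf; rewrite eq_sym => ->.
  by rewrite -dvdn_divisors // dvdn_div ?dvdn_gcdl.
rewrite (exchange_big_dep xpredT) //=; apply: eq_big_seq => m.
rewrite -dvdn_divisors // => mN.
by rewrite sum_nat_cond_const -card_ordz // cardsE.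
Qed.

(** Such a word is primitive: a period would translate its jump to another jump for the same shift,
    against [jump_inj]. *)
Lemma rotw_sub_inj w : K2_word w != set0 -> injective (fun k : G => rotw k w).
Proof.
case/set0Pn => j /K2_wordP[x [y J]] k1 k2 E.
have pw i : tnth w (i - (k2 - k1)) = tnth w i.
  have := congr1 (fun u => tnth u (i + k1)) E; rewrite !tnth_rotw_sub addrK => ->.
  by rewrite opprB addrA.
have J' : jump w j (x + (k2 - k1)) (y + (k2 - k1)).
  case: J => nxy J; split; first by rewrite (inj_eq (addIr _)).
  by move=> i; rewrite -!subr_eq -(pw i) -(pw (i - j)) (addrAC i) J.
have [/eqP + _] := jump_inj J J'.
by rewrite -subr_eq0 opprD addNKr oppr_eq0 subr_eq0 => /eqP.
Qed.

Lemma bigminn_le (s : seq nat) (F : nat -> nat) d (k : nat) :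
  k \in s -> (\big[minn/d]_(i <- s) F i <= F k)%N.
Proof.
elim: s => // i s IHs; rewrite inE big_cons geq_min => /orP[/eqP->|/IHs->].
  by rewrite leqnn.
by rewrite orbT.
Qed.

Lemma bigminn_attained (s : seq nat) (F : nat -> nat) d :
  \big[minn/d]_(i <- s) F i = d \/
  exists2 k : nat, k \in s & \big[minn/d]_(i <- s) F i = F k.
Proof.
elim: s => [|i s IHs]; first by left; rewrite big_nil.
rewrite big_cons /minn; case: ifP => _; first by right; exists i; rewrite ?mem_head.
by case: IHs => [|[k ks]] ->; [left | right; exists k; rewrite // inE ks orbT].
Qed.

(** If some shift is at distance 2, then [w] is primitive, so every distance is nonzero and even,
    hence at least 2. *)
Lemma delta_word_eq2 w : (delta_word w == 2) = (K2_word w != set0).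
Proof.
have inK (k : nat) : (0 < k < N)%N -> shift_dist w k = 2 -> K2_word w != set0.
  case/andP=> k_gt0 kN dk; apply/set0Pn; exists (Ordinal kN).
  by rewrite inE /= k_gt0 dk.
apply/eqP/idP => [d2 | K0].
  have := bigminn_attained (index_iota 1 N) (shift_dist w) N.
  rewrite -/(delta_word w) d2 => -[N2|[k]]; last first.
    by rewrite mem_index_iota => /inK K /esym.
  (* The minimum could equal its default value [N]; then [N = 2], and the distance at shift 1 lies
     between the minimum 2 and the length 2. *)
  have one : 1%N \in index_iota 1 N by rewrite mem_index_iota.
  apply: (inK 1%N) => //; apply/eqP; rewrite eqn_leq.
  have := bigminn_le (shift_dist w) N one; rewrite -/(delta_word w) d2 => ->.
  by rewrite andbT [X in (_ <= X)%N]N2 -[X in (_ <= X)%N]card_ord max_card.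
have ge2 (k : G) : k != 0 -> (2 <= shift_dist w k)%N.
  move=> k0; rewrite shift_distE -[2%N]/(1.*2) leq_double lt0n.
  apply: contraNneq k0 => U0; apply/eqP/(rotw_sub_inj K0).
  have dk : shift_dist w k = 0%N by rewrite shift_distE U0.
  apply: eq_from_tnth => i; rewrite [RHS]tnth_rotw_sub subr0.
  move/eqP: dk; rewrite cards_eq0 => /eqP/setP/(_ i); rewrite !inE.
  by case: eqP.
have [k] := set0Pn _ K0; rewrite inE => /andP[k_gt0 /eqP dk].
apply/eqP; rewrite eqn_leq; apply/andP; split.
  by rewrite -[X in (_ <= X)%N]dk; apply: bigminn_le; rewrite mem_index_iota k_gt0 /=.
rewrite /delta_word.
have [->//|[j]] := bigminn_attained (index_iota 1 N) (shift_dist w) N.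
rewrite mem_index_iota => /andP[j_gt0 jN] ->.
by apply: (ge2 (Ordinal jN)); rewrite -val_eqE /= -lt0n.
Qed.

Lemma rotwD i j w : rotw i (rotw j w) = rotw (i + j)%R w.
Proof. by apply: eq_from_tnth => k; rewrite !tnth_rotw_sub opprD addrA. Qed.

Lemma mem_necklace w w' : (w' \in necklace w) = (necklace w' == necklace w).
Proof.
have mem0 u : u \in necklace u.
  apply/imsetP; exists (0 : G) => //; apply: eq_from_tnth => i.
  by rewrite tnth_rotw_sub subr0.
apply/idP/eqP => [|<-]; last exact: mem0.
case/imsetP=> j _ ->; apply/setP=> u; apply/imsetP/imsetP => -[i _ ->].
  by exists (i + j) => //; rewrite rotwD.
by exists (i - j) => //; rewrite rotwD subrK.
Qed.

(** The words split into rotation orbits, on which [K2_word] is constant, and each orbit has [N]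
    elements by [rotw_sub_inj]. *)
Lemma card_words_D2 (Q : pred {set G}) :
  #|[set w | (K2_word w != set0) && Q (K2_word w)]| =
  (N * #|[set X in D2 N | Q (K2 X)]|)%N.
Proof.
set S := [set w | _].
have D2E : [set X in D2 N | Q (K2 X)] = [set necklace w | w in S].
  apply/setP=> X; rewrite !inE /=; apply/andP/imsetP => [[] | [w + ->]].
    case/andP=> /imsetP[w _ ->]; rewrite delta_necklace K2_necklace delta_word_eq2.
    by move=> K0 Qw; exists w; rewrite // inE K0.
  rewrite inE -delta_word_eq2 -delta_necklace -K2_necklace => /andP[-> ->].
  by rewrite imset_f.
rewrite D2E -sum1_card (partition_big_imset (@necklace N)) /= mulnC -sum_nat_const.
apply: eq_bigr => X /imsetP[w wS ->]; rewrite sum1dep_card.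
have K0 : K2_word w != set0 by move: wS; rewrite inE => /andP[].
rewrite -[RHS](card_ord N) -(card_imset predT (rotw_sub_inj K0)).
apply: eq_card => u; rewrite !inE -mem_necklace.
rewrite andb_idl // => /imsetP[j _ ->]; move: wS; rewrite !inE.
suff -> : K2_word (rotw j w) = K2_word w by [].
by apply/setP=> k; rewrite !inE shift_dist_rotw.
Qed.
End Counting.

(** * Class membership of the two shapes of [K2] *)

Lemma biggcdn_dvd (I : eqType) (r : seq I) (P : pred I) (F : I -> nat) d j :
  j \in r -> P j -> (\big[gcdn/d]_(i <- r | P i) F i %| F j)%N.
Proof.
elim: r => // i r IHr; rewrite inE big_cons => /orP[/eqP <- -> | jr Pj].
  exact: dvdn_gcdl.
case: ifP => _; last exact: IHr.
by apply: dvdn_trans (IHr jr Pj); apply: dvdn_gcdr.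
Qed.

Section Classes.
Variable n : nat.
Local Notation N := n.+2.
Local Notation G := 'I_n.+2.
Implicit Types (w u v : word N) (i j k x y : G) (a t : nat) (K : {set G}).

(** For [t] dividing [N] this is the set [multiples N t], expressed by divisibility of
    representatives. *)
Definition nz_multiples t : {set G} := [set j : G | (0 < j)%N && (t %| j)%N].

Lemma mem_nz_multiples t c (lt_ct : (c * t < N)%N) : (0 < c * t)%N ->
  Ordinal lt_ct \in nz_multiples t.
Proof. by move=> ct_gt0; rewrite inE /= ct_gt0 dvdn_mull. Qed.

Lemma isHT_multiples t : (t %| N)%N -> (t.*2 < N)%N ->
  isHT (nz_multiples t) = ~~ odd (N %/ t).
Proof.
move=> tN lt2t; have [c Nc] := dvdnP tN.
have t_gt0 : (0 < t)%N by apply: dvdn_gt0 tN.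
have cE : (N %/ t)%N = c by rewrite [X in (X %/ _)%N]Nc mulnK.
rewrite cE; apply/idP/idP => [|oc].
  case/andP=> /dvdnP[h Nh] /existsP[k]; rewrite inE => /andP[/andP[_ /dvdnP[b kb]]].
  rewrite kb [X in (X %/ _)%N]Nh mulnK // => /eqP bh.
  have : (c * t = b.*2 * t)%N by rewrite -Nc Nh -bh -muln2 -!mulnA (mulnC t).
  by move/eqP; rewrite eqn_pmul2r // => /eqP ->; rewrite odd_double.
have cdb : c = (c./2).*2 by rewrite -[LHS]odd_double_half (negPf oc).
have N2 : (N %/ 2 = c./2 * t)%N.
  by rewrite [X in (X %/ _)%N]Nc [X in (X * t)%N]cdb -muln2 mulnAC mulnK.
have ltN : (c./2 * t < N)%N by rewrite -N2; lia.
rewrite /isHT N2; apply/andP; split.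
  by rewrite [X in (_ %| X)%N]Nc cdb -muln2 -mulnA dvdn_mull // dvdn_mulr.
apply/existsP; exists (Ordinal ltN); rewrite eqxx andbT mem_nz_multiples // -N2; lia.
Qed.

Lemma isSP_multiples t : (t %| N)%N -> (t.*2 < N)%N ->
  isSP (nz_multiples t) = (N == (3 * t)%N).
Proof.
move=> tN lt2t; have [c Nc] := dvdnP tN.
have t_gt0 : (0 < t)%N by apply: dvdn_gt0 tN.
have c_ge3 : (3 <= c)%N by rewrite -(ltn_pmul2r t_gt0) -Nc; lia.
apply/idP/eqP => [/existsP[k /and3P[k_gt0 lt2k /eqP E]] | N3].
  have mem b : (0 < b < c)%N -> (b * t == k :> nat) || (b * t == N - k :> nat)%N.
    case/andP=> b_gt0 bc.
    have lt_bt : (b * t < N)%N by rewrite [X in (_ < X)%N]Nc ltn_pmul2r.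
    have := mem_nz_multiples lt_bt; rewrite muln_gt0 b_gt0 t_gt0 E inE /=; exact.
  case: (ltngtP c 3) => [|c_gt3|c3]; [by lia | | by rewrite [LHS]Nc c3].
  have {}mem b : (0 < b < 4)%N -> (b * t == k :> nat) || (b * t == N - k :> nat)%N.
    by move=> b4; apply: mem; lia.
  (* The three distinct multiples [t], [2 t], [3 t] cannot all lie in a pair. *)
  by have := mem 1%N isT; have := mem 2%N isT; have := mem 3%N isT; lia.
have lt1 : (1 * t < N)%N by lia.
apply/existsP; exists (Ordinal lt1); rewrite /= mul1n t_gt0 mul2n lt2t /=.
apply/eqP/setP=> j; rewrite !inE; apply/andP/orP => [[j_gt0 /dvdnP[b jb]] | [] /eqP jE].
- have := ltn_ord j; rewrite jb [X in (_ < X)%N]N3 ltn_pmul2r //.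
  case: b jb => [|[|[|b]]] jb // _; first by rewrite jb in j_gt0.
    by left; rewrite mul1n.
  by right; apply/eqP; lia.
- by rewrite jE t_gt0 dvdnn.
have -> : nat_of_ord j = (2 * t)%N by lia.
by rewrite dvdn_mull // muln_gt0 t_gt0.
Qed.

(** The gcd of the set is [t], since [t] belongs to it and divides [N] and all members. *)
Lemma isSUB_multiples t : (t %| N)%N -> (t.*2 < N)%N -> isSUB (nz_multiples t).
Proof.
move=> tN lt2t; have t_gt0 : (0 < t)%N by apply: dvdn_gt0 tN.
have lt1 : (1 * t < N)%N by lia.
have tM : Ordinal lt1 \in nz_multiples t by rewrite mem_nz_multiples // mul1n.
have gE : gcd_shifts (nz_multiples t) = t.
  apply/eqP; rewrite eqn_dvd; apply/andP; split.
    by rewrite -[X in (_ %| X)%N]mul1n (biggcdn_dvd _ _ (mem_index_enum (Ordinal lt1))).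
  rewrite /gcd_shifts; elim/big_ind: _ => // [a b ta tb|j]; first by rewrite dvdn_gcd ta.
  by rewrite inE => /andP[].
rewrite /isSUB gE; apply/eqP/setP => j; rewrite !inE; congr (_ && _).
apply/idP/existsP => [/dvdnP[c jc] | [i /eqP ij]]; last first.
  by rewrite -(modn_small (ltn_ord j)) ij /dvdn modn_dvdm // modnMr.
have cN : (c < N)%N by rewrite (leq_ltn_trans _ (ltn_ord j)) // jc leq_pmulr.
by exists (Ordinal cN); rewrite /= mulnC -jc.
Qed.

(** The witness is whichever of [k] and [N - k] is below [N / 2]. *)
Lemma isSP_pair k : k + k != 0 -> isSP [set k; - k].
Proof.
move=> kk0; have k_gt0 : (0 < k)%N.
  rewrite lt0n; apply: contraNneq kk0 => k0.
  by rewrite (_ : k = 0) ?addr0 //; apply: val_inj.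
have oppE : nat_of_ord (- k) = (N - k)%N by rewrite /= modn_small //; lia.
have lk := ltn_ord k.
have n2k : (2 * k != N)%N.
  by apply: contraNneq kk0 => E; rewrite -val_eqE /= addnn -mul2n E modnn.
case: (ltnP (2 * k) N) => lt2k.
  apply/existsP; exists k; rewrite k_gt0 lt2k; apply/eqP/setP=> j.
  by rewrite !inE -!val_eqE -oppE.
have kE : (N - (N - k) = k)%N by rewrite subKn // ltnW.
apply/existsP; exists (- k); rewrite oppE kE; apply/and3P; split; try lia.
by apply/eqP/setP=> j; rewrite !inE -!val_eqE -oppE orbC.
Qed.

Lemma not_isHT_pair k : k + k != 0 -> ~~ isHT [set k; - k].
Proof.
move=> kk0; apply/negP => /andP[/dvdnP[h Nh] /existsP[j /andP[jk /eqP jE]]].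
have jj0 : j + j = 0.
  by apply: val_inj; rewrite /= jE [X in (X %/ _)%N]Nh mulnK // addnn -muln2 -Nh modnn.
move: jk; rewrite in_set2 => /orP[] /eqP jk; move: kk0; rewrite -oppr_eq0.
  by rewrite -jk jj0 oppr0 eqxx.
by rewrite opprD -jk jj0 eqxx.
Qed.

Lemma genericP w : w \in generic n -> exists k,
  [/\ K2_word w = [set k; - k], k + k != 0 & (3 < ordz k)%N].
Proof.
rewrite inE => /existsP[k /existsP[a /and3P[a1 a2]]].
rewrite inE => /existsP[x /jumpP J].
exists k; split; first exact: K2_generic J; last by lia.
by rewrite -mulr2n mulrn_Zp_eq0; apply/negP => /dvdn_leq; lia.
Qed.

Lemma defectsP w t : (t.*2 < N)%N -> w \in defects n t ->
  (t %| N)%N /\ K2_word w = nz_multiples t.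
Proof.
move=> lt2t; rewrite inE => /existsP[x /eqP tE].
by rewrite -tE; split; [exact: min_period_dvd | apply: K2_flip; rewrite tE].
Qed.

Lemma nz_multiples_neq0 t : (0 < t)%N -> (t.*2 < N)%N -> nz_multiples t != set0.
Proof.
move=> t_gt0 lt2t; have lt1 : (1 * t < N)%N by lia.
by apply/set0Pn; exists (Ordinal lt1); rewrite mem_nz_multiples // mul1n.
Qed.

(** Otherwise [k] would be a multiple of [N / 3], of order dividing 3, whereas generic shifts have
    order above 3. *)
Lemma generic_not_defect w t : (3 * t = N)%N ->
  w \in generic n -> w \notin defects n t.
Proof.
move=> N3 /genericP[k [Kw _ ordk]]; apply/negP => /defectsP[|_]; first by lia.
rewrite Kw => /setP/(_ k); rewrite in_set2 eqxx inE => /esym/andP[_ tk].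
have : k *+ 3 == 0.
    rewrite Zp_mulrn -val_eqE /= mulnC -[_ == _]/(N %| _)%N -[X in (X %| _)%N]N3.
    by rewrite dvdn_pmul2l.
by rewrite mulrn_Zp_eq0 => /dvdn_leq; lia.
Qed.

End Classes.

(** * Sizes of the classes *)

Section ClassSizes.
Variable n : nat.
Local Notation N := n.+2.
Local Notation G := 'I_n.+2.
Implicit Types (w u v : word N) (i j k x y : G) (a t : nat) (K : {set G}).
Local Notation nprim t := #|[set u : word N | min_period u == t]|.

Definition sub_period t := [&& t %| N, odd (N %/ t) & 5 <= N %/ t]%N.

Lemma sub_period_lt t : sub_period t -> (0 < t /\ t.*2 < N)%N.
Proof.
case/and3P=> /dvdnP[c Nc] _.
have t_gt0 : (0 < t)%N by case: t Nc => //; rewrite muln0.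
rewrite [X in (X %/ _)%N]Nc mulnK // => c5; split=> //.
by rewrite [X in (_ < X)%N]Nc -muln2 mulnC ltn_pmul2r //; lia.
Qed.

Lemma third_lt : ((N %/ 3).*2 < N)%N.
Proof. lia. Qed.

(** The shift [N / 2] has order 2, so its arcs have length 1 and the words are those of
    [arcs (half_shift n) 1]. *)
Lemma card_HT_words :
  #|[set w : word N | (K2_word w != set0) && isHT (K2_word w)]| =
  (if 2 %| N then N * 2 ^ (N %/ 2 - 1) else 0)%N.
Proof.
case: ifP => N2; last first.
  by apply/eqP; rewrite cards_eq0; apply/eqP/setP=> w; rewrite !inE /isHT N2 andbF.
have Nh : (N %/ 2 * 2 = N)%N by rewrite divnK.
have gE : gcdn N (half_shift n) = (N %/ 2)%N.
  by rewrite half_shift_val -{1}Nh gcdnC gcdnMr.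
have oE : ordz (half_shift n) = 2.
  by rewrite /ordz gE -{1}Nh mulKn //; lia.
rewrite subn1 -gE -(@card_arcs n _ 1) ?oE //; apply: eq_card => w.
rewrite !inE isHT_K2 N2 /=; apply/andP/existsP => [[_ /K2_wordP[x [y J]]]|[x /jumpP J]].
  have [a] := jump_arc J; rewrite oE => a2 ya.
  by exists x; apply/jumpP; rewrite (_ : 1%N = a) -?ya //; lia.
have hK : half_shift n \in K2_word w by apply/K2_wordP; do 2!eexists; apply: J.
by split=> //; apply/set0Pn; exists (half_shift n).
Qed.

(** By [K2_cases], a word outside HT is generic, with [K2] a pair, or has one defect in a period
    [t]; the nonzero multiples of [t] form a pair only for [N = 3 t]. *)
Lemma SP_wordsE :
  [set w : word N | (K2_word w != set0) &&
    (~~ isHT (K2_word w) && isSP (K2_word w))] =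
  generic n :|: (if (3 %| N)%N then defects n (N %/ 3) else set0).
Proof.
apply/setP=> w; rewrite inE in_setU.
apply/andP/orP => [[K0 /andP[nHT SP]] | []].
- case: (K2_cases K0) => [HT|gw|[x lt2t]]; [by rewrite HT in nHT | by left | right].
  have tN := min_period_dvd (flip x w).
  move: SP; rewrite (K2_flip lt2t) -/(nz_multiples n _) isSP_multiples // => /eqP N3.
  rewrite [X in (3 %| X)%N]N3 dvdn_mulr // inE; apply/existsP; exists x.
  by rewrite [X in (X %/ _)%N]N3 mulKn.
- move/genericP=> [k [-> kk0 _]]; rewrite not_isHT_pair // isSP_pair //.
  by split=> //; apply/set0Pn; exists k; rewrite set21.
case: ifP => [N3|_]; last by rewrite inE.
have E : N = (3 * (N %/ 3))%N by rewrite mulnC divnK.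
case/(defectsP third_lt) => tN ->; rewrite isHT_multiples ?third_lt //.
rewrite isSP_multiples ?third_lt // -E eqxx nz_multiples_neq0 ?third_lt //; last by lia.
by rewrite [X in odd (X %/ _)]E mulnK //; lia.
Qed.

(** Both sides are doubled because [card_generic] counts each generic word twice. *)
Lemma card_SP_words :
  #|[set w : word N | (K2_word w != set0) &&
    (~~ isHT (K2_word w) && isSP (K2_word w))]|.*2 =
  (N * ((if 3 %| N then nprim (N %/ 3)%N else 0).*2 +
    \sum_(m <- divisors N) totient m * ((m - 3) * 2 ^ (N %/ m).-1)))%N.
Proof.
rewrite SP_wordsE cardsU (_ : _ :&: _ = set0) ?cards0 ?subn0; last first.
  apply/setP=> w; rewrite in_setI in_set0; apply/negbTE/negP => /andP[gw].
  case: ifP => [N3|_]; last by rewrite inE.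
  by apply/negP/generic_not_defect; rewrite // mulnC divnK.
rewrite doubleD card_generic addnC mulnDr; congr (_ + _)%N.
  case: ifP => _; last by rewrite cards0 muln0.
  by rewrite card_defects ?third_lt // doubleMr.
congr (N * _)%N; rewrite -(@sum_ordz n (fun m => (m - 3) * 2 ^ (N %/ m).-1)%N).
by apply: eq_bigr => k _; rewrite gcdn_ordz.
Qed.

Lemma SUB_wordsE :
  [set w : word N | (K2_word w != set0) &&
    [&& ~~ isHT (K2_word w), ~~ isSP (K2_word w) & isSUB (K2_word w)]] =
  \bigcup_(t : G) (if sub_period t then defects n t else set0).
Proof.
apply/setP=> w; rewrite inE; apply/andP/bigcupP => [[K0 /and3P[nHT nSP _]] | [t _]].
  case: (K2_cases K0) => [HT|/genericP[k [Kw kk0 _]]|[x lt2t]].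
  - by rewrite HT in nHT.
  - by rewrite Kw isSP_pair in nSP.
  move: nHT nSP; rewrite (K2_flip lt2t) -/(nz_multiples n _).
  set t := min_period _ in lt2t *; have tN : (t %| N)%N := min_period_dvd _.
  have t_gt0 : (0 < t)%N by apply: dvdn_gt0 tN.
  rewrite isHT_multiples // isSP_multiples // negbK => oN N3.
  have lt_t : (t < N)%N by lia.
  exists (Ordinal lt_t) => //; rewrite /sub_period /= tN oN /=.
  case: ifP => [_|/negbT]; first by rewrite inE; apply/existsP; exists x.
  (* The quotient [c = N / t] is odd, above 2 and different from 3, hence at least 5. *)
  have [c Nc] := dvdnP tN; move: oN N3; rewrite [X in odd (X %/ _)]Nc.
  rewrite [X in (_ <= X %/ _)%N]Nc [X in X != _]Nc mulnK // eqn_pmul2r //.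
  have : (2 < c)%N by rewrite -(ltn_pmul2r t_gt0) -Nc mul2n.
  by case: c {Nc} => [|[|[|[|[|c]]]]].
case: ifP => [st|_]; last by rewrite inE.
have [t_gt0 lt2t] := sub_period_lt st; case/and3P: st => tN oN N5.
case/(defectsP lt2t) => _ ->; rewrite nz_multiples_neq0 // isSUB_multiples //.
rewrite isHT_multiples // oN isSP_multiples //=; split=> //; rewrite andbT.
by apply/eqP => E; have := mulnK 3 t_gt0; rewrite -E => E3; rewrite E3 in N5.
Qed.

(** The union over [t] is disjoint: [K2] determines [t], as two periods with the same nonzero
    multiples divide each other. *)
Lemma card_SUB_words :
  #|[set w : word N | (K2_word w != set0) &&
    [&& ~~ isHT (K2_word w), ~~ isSP (K2_word w) & isSUB (K2_word w)]]| =
  (N * \sum_(t <- divisors N | odd (N %/ t) && (5 <= N %/ t)) nprim t)%N.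
Proof.
rewrite SUB_wordsE -sum1_card partition_disjoint_bigcup => [|s t nst]; last first.
  rewrite disjoints_subset; apply/subsetP => w; rewrite inE.
  case: ifP => [ss|_]; last by rewrite inE.
  case: ifP => [st|_]; last by rewrite !inE.
  have [s_gt0 lt2s] := sub_period_lt ss; have [t_gt0 lt2t] := sub_period_lt st.
  case/(defectsP lt2s) => _ Ks; apply/negP => /(defectsP lt2t)[_ Kt].
  case/eqP: nst; apply: val_inj; apply/eqP; rewrite eqn_dvd; rewrite Ks in Kt.
  move/setP: Kt => E; have := E s; have := E t.
  by rewrite !inE s_gt0 t_gt0 !dvdnn /= => -> <-.
under eq_bigr do rewrite sum1_card.
rewrite big_distrr -[RHS]big_filter /=.
rewrite (perm_big [seq t <- index_iota 0 N | sub_period t]); last first.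
  apply: uniq_perm; rewrite ?filter_uniq ?divisors_uniq ?iota_uniq // => t.
  rewrite !mem_filter -dvdn_divisors // mem_index_iota /=.
  have -> : (odd (N %/ t) && (5 <= N %/ t) && (t %| N))%N = sub_period t.
    by rewrite /sub_period andbC.
  rewrite andb_idr // => /sub_period_lt[]; lia.
rewrite big_filter big_mkord big_mkcond [RHS]big_mkcond; apply: eq_bigr => t _.
case: ifP => [st|_]; last by rewrite cards0.
by have [_ lt2t] := sub_period_lt st; rewrite card_defects.
Qed.

Lemma D2MP_eq0 : D2MP N = set0.
Proof.
apply/setP=> X; rewrite !inE -/(X \in necklaces N); apply/negbTE/negP.
case/andP=> /andP[/imsetP[w _ ->] /andP[_]].
rewrite delta_necklace delta_word_eq2 K2_necklace => K0.
case: (K2_cases K0) => [->|/genericP[k [-> kk0 _]]|[x lt2t]] //.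
  by rewrite isSP_pair // andbF.
by rewrite (K2_flip lt2t) -/(nz_multiples n _) isSUB_multiples ?andbF ?min_period_dvd.
Qed.

Lemma card_D2HT : #|D2HT N| = (if 2 %| N then 2 ^ (N %/ 2 - 1) else 0)%N.
Proof.
apply/eqP; rewrite -(@eqn_pmul2l N) // -card_words_D2 card_HT_words.
by case: ifP; rewrite ?muln0.
Qed.

Lemma card_D2SP :
  #|D2SP N|%:R =
    (if (3 %| N)%N then prim_words (N %/ 3)%N else 0)
    + \sum_(m <- divisors N | (4 <= m)%N)
        (totient m)%:R / 2 * 2 ^+ (N %/ m - 1)%N * (m%:R - 3) :> rat.
Proof.
have E := card_SP_words; rewrite (card_words_D2 (fun K => ~~ isHT K && isSP K)) in E.
move/eqP: E; rewrite doubleMr eqn_pmul2l // -/(D2SP N) => /eqP E.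
have {}E : #|D2SP N|%:R * 2 = (if (3 %| N)%N then prim_words (N %/ 3)%N else 0) * 2
  + \sum_(m <- divisors N) (totient m * ((m - 3) * 2 ^ (N %/ m).-1))%:R :> rat.
  rewrite -natrM muln2 E natrD natr_sum -muln2 natrM; congr (_ * _ + _).
  by case: ifP => // N3; rewrite (@prim_wordsE n) // dvdn_div.
apply: (mulIf (_ : 2 != 0 :> rat)) => //; rewrite E mulrDl; congr (_ + _).
rewrite mulr_suml [RHS]big_mkcond; apply: eq_bigr => m _.
(* For [m <= 3] the truncated difference [m - 3] is 0, so only the terms with [m >= 4] remain. *)
case: leqP => m4.
  by have /eqP -> : (m - 3 == 0)%N; rewrite ?mul0n ?muln0.
by rewrite !natrM natrB ?(ltnW m4) // natrX subn1; field.
Qed.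

Lemma card_D2SUB :
  #|D2SUB N|%:R =
    \sum_(t <- divisors N | odd (N %/ t) && (5 <= N %/ t)%N) prim_words t :> rat.
Proof.
have E := card_SUB_words.
rewrite (card_words_D2 (fun K => [&& ~~ isHT K, ~~ isSP K & isSUB K])) in E.
move/eqP: E; rewrite eqn_pmul2l // -/(D2SUB N) => /eqP ->.
rewrite natr_sum big_seq_cond [RHS]big_seq_cond; apply: eq_bigr => t.
rewrite -dvdn_divisors // => /andP[tN _].
by rewrite -prim_wordsE.
Qed.
End ClassSizes.

(** * Partition into classes and the total count *)

Lemma D2_partition n : D2MP n = set0 -> D2 n = D2HT n :|: D2SP n :|: D2SUB n.
Proof.
move=> MP0; apply/setP=> X; have := in_set0 X; rewrite -MP0 !in_setU !in_set.
move: (_ && _) (isHT _) (isSP _) (isSUB _) => b1 b2 b3 b4.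
by case: b1; case: b2; case: b3; case: b4.
Qed.

Lemma D2_disjoint n :
  [/\ [disjoint D2HT n & D2SP n], [disjoint D2HT n & D2SUB n]
    & [disjoint D2SP n & D2SUB n]].
Proof.
by split; rewrite disjoints_subset; apply/subsetP => X; rewrite !inE;
  case: (isHT _); rewrite ?andbF //; case: (isSP _); rewrite ?andbF.
Qed.

Lemma card_D2 n : D2MP n = set0 -> #|D2 n| = (#|D2HT n| + #|D2SP n| + #|D2SUB n|)%N.
Proof.
have [/disjoint_setI0 d1 /disjoint_setI0 d2 /disjoint_setI0 d3] := D2_disjoint n.
move/D2_partition->.
by rewrite !cardsU setIUl d1 d2 d3 setU0 !cards0 !subn0.
Qed.

Lemma D2_1 : D2 1 = set0.
Proof. by apply/setP=> X; rewrite !inE andbF. Qed.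

Theorem theorem1p1 (n : nat) (n_ge1 : (1 <= n)%N) :
  [/\ D2 n = D2HT n :|: D2SP n :|: D2SUB n,
      [/\ [disjoint D2HT n & D2SP n], [disjoint D2HT n & D2SUB n]
        & [disjoint D2SP n & D2SUB n]]
    & D2MP n = set0]
  /\
  [/\ #|D2HT n|%:R = (if (2 %| n)%N then 2 ^+ (n %/ 2 - 1)%N else 0) :> rat,
      #|D2SP n|%:R =
        (if (3 %| n)%N then prim_words (n %/ 3)%N else 0)
        + \sum_(m <- divisors n | (4 <= m)%N)
            (totient m)%:R / 2 * 2 ^+ (n %/ m - 1)%N * (m%:R - 3) :> rat
    & #|D2SUB n|%:R =
        \sum_(tau <- divisors n | odd (n %/ tau) && (5 <= n %/ tau)%N)
            prim_words tau :> rat]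
  /\
  #|D2 n|%:R =
    (if (2 %| n)%N then 2 ^+ (n %/ 2 - 1)%N else 0)
    + (if (3 %| n)%N
       then \sum_(d <- divisors (n %/ 3)) mobius d * 2 ^+ (n %/ (3 * d))%N
       else 0)
    + \sum_(m <- divisors n | (4 <= m)%N)
        (totient m)%:R / 2 * 2 ^+ (n %/ m - 1)%N * (m%:R - 3)
    + \sum_(tau <- divisors n | odd (n %/ tau) && (5 <= n %/ tau)%N)
        \sum_(d <- divisors tau) mobius d * 2 ^+ (tau %/ d)%N :> rat
  /\
  #|D2 n|%:R =
    (if (2 %| n)%N then 2 ^+ (n %/ 2 - 1)%N else 0)
    + (if (3 %| n)%N then prim_words (n %/ 3)%N else 0)
    + \sum_(m <- divisors n | (4 <= m)%N)
        (totient m)%:R / 2 * 2 ^+ (n %/ m - 1)%N * (m%:R - 3)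
    + \sum_(tau <- divisors n | odd (n %/ tau) && (5 <= n %/ tau)%N)
        prim_words tau :> rat.
Proof.
have [MP0 HT SP SUB] : [/\ D2MP n = set0,
    #|D2HT n|%:R = (if (2 %| n)%N then 2 ^+ (n %/ 2 - 1)%N else 0) :> rat,
    #|D2SP n|%:R = (if (3 %| n)%N then prim_words (n %/ 3)%N else 0)
        + \sum_(m <- divisors n | (4 <= m)%N)
            (totient m)%:R / 2 * 2 ^+ (n %/ m - 1)%N * (m%:R - 3) :> rat
  & #|D2SUB n|%:R =
        \sum_(tau <- divisors n | odd (n %/ tau) && (5 <= n %/ tau)%N)
            prim_words tau :> rat].
  case: n n_ge1 => [|[|n]] // _; last first.
    split; [exact: D2MP_eq0 | | exact: card_D2SP | exact: card_D2SUB].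
    by rewrite card_D2HT; case: ifP; rewrite ?natrX.
  (* For [n = 1] all classes are empty, and on the right the only divisor 1 satisfies none of the
     summation conditions. *)
  have E (Q : pred {set word 1}) : [set X in D2 1 | Q X] = set0.
    by apply/setP=> X; rewrite D2_1 !inE.
  rewrite /D2MP /D2HT /D2SP /D2SUB !E !cards0 (_ : divisors 1 = [:: 1%N]) //.
  by rewrite !big_cons !big_nil /= addr0.
have P3 : (if (3 %| n)%N
       then \sum_(d <- divisors (n %/ 3)) mobius d * 2 ^+ (n %/ (3 * d))%N
       else 0) = (if (3 %| n)%N then prim_words (n %/ 3)%N else 0).
  by case: ifP => // _; apply: eq_bigr => d _; rewrite divnMA.
have total := congr1 (fun c => c%:R : rat) (card_D2 MP0).
rewrite /= !natrD HT SP SUB addrA in total.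
split; first by split=> //; [exact: D2_partition | exact: D2_disjoint].
by split; [split | split; rewrite ?P3].
Qed.
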